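(* For each real constant $c>0$ and each integer $m>0$ there is an integer $n>m$ such that $\phi(n)\geq \left(\frac{2}{9}-c\right)n$.
   Context: Let $A$ be a finite alphabet with at least two letters. A word $w\in A^*$ is rich if it contains exactly $|w|+1$ distinct palindromic factors (contiguous subwords), including the empty word $\epsilon$. Let $R$ be the set of all rich words over $A$. A rich word $w$ can be extended in at least two ways if there are two distinct letters $x,y\in A$ such that $wx,wy\in R$. For $w\in R$, let $K(w)$ be the set of all words $u\in A^*$ such that $wu\in R$ and $wu$ can be extended in at least two ways (so $\epsilon\in K(w)$ if $w$ can be extended in at least two ways). Let $\omega(w)=\min\{|u| \mid u\in K(w)\}$, and for $n>0$ let $\phi(n)=\max\{\omega(w)\mid w\in R,\ |w|=n\}$. *)

(* Defs.v *)
From mathcomp Require Import all_boot all_order all_algebra.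
From mathcomp Require Import boolp classical_sets reals.

Set Implicit Arguments.
Unset Strict Implicit.
Unset Printing Implicit Defensive.

Local Open Scope classical_set_scope.

Section RichWords.
Variable A : finType.
Implicit Types (u w : seq A) (n k : nat).

Definition palindrome u : bool := rev u == u.

(* Words are of type [seq A]. The set is taken in the finite type of words of
   length at most [size w], which contains every factor of [w]. *)
Definition palindromic_factors w : {set (size w).-bseq A} :=
  [set u : (size w).-bseq A | infix u w && palindrome u]%SET.

Definition rich w : bool := #|palindromic_factors w| == (size w).+1.

Definition extends_two_ways w : Prop :=
  exists x y : A, [/\ x != y, rich (rcons w x) & rich (rcons w y)].

Definition K w : set (seq A) :=
  [set u | rich (w ++ u) /\ extends_two_ways (w ++ u)].

Definition is_min_size (S : set (seq A)) k : Prop :=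
  (exists2 u, S u & size u = k) /\ (forall u, S u -> (k <= size u)%N).

(* The minimum of the sizes of the words in [K w]; the default value [0] is
   only used if [K w] is empty, where the minimum is not defined. *)
Definition omega w : nat := xget 0%N [set k | is_min_size (K w) k].

Definition phi n : nat := (\max_(w : n.-tuple A | rich w) omega w)%N.

End RichWords.

Arguments phi A n : clear implicits.

(* Main.v *)
Require Import Defs.
From mathcomp Require Import all_boot all_order all_algebra.
From mathcomp Require Import boolp classical_sets reals.
From mathcomp Require Import zify lra.
Import Order.TTheory GRing.Theory Num.Theory.

(* Call a letter [x] new after [w] if [wx] has a palindromic suffix that does not
   occur in [w]; a word is rich iff all its letters are new when read from left
   to right, so a long forced extension is a word [u] such that after each
   proper prefix of [u] exactly one letter is new.

   Over two letters [c] and [c' = ~~ c], the morphism [c |-> cc', c' |-> c'],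
   preceded by a block [c'c], maps palindromic suffixes to palindromic suffixes
   and preserves new letters in both directions. The doubled [c] it creates at
   the front is what makes [c] not new after a single [c], so that forced
   extensions are mapped to forced extensions. Exchanging the roles of the two
   letters, this can be iterated. The letter counts of the word and of its
   extension both grow like Fibonacci numbers, hence their ratio converges and
   its limit is determined by the starting word: a word of length 41 with a
   forced extension of length 11, found by computer search, gives a limit
   strictly above 2/9. The slack pays for the remaining letters of the alphabet,
   each of which is put once at the front. *)

Set Implicit Arguments.
Unset Strict Implicit.
Unset Printing Implicit Defensive.

(** * Richness read letter by letter *)

(** The range of [k] gives exactly the nonempty suffixes; the boolean form lets concrete words be
    checked by evaluation. *)
Definition new_pal (A : eqType) (w : seq A) (x : A) : bool :=
  has (fun k => let s := drop k (rcons w x) in (rev s == s) && ~~ infix s w)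
      (iota 0 (size w).+1).

Lemma new_palP (A : eqType) (w : seq A) (x : A) :
  reflect (exists s p, [/\ rcons w x = s ++ p, rev p = p & ~~ infix p w])
          (new_pal w x).
Proof.
apply: (iffP hasP) => [[k _ /andP[/eqP pal_p np]]|[s [p [eq_sp pal_p np]]]].
  by exists (take k (rcons w x)), (drop k (rcons w x)); rewrite cat_take_drop.
exists (size s); last by rewrite eq_sp drop_size_cat //= pal_p eqxx.
have p0 : 0 < size p by case: p np {eq_sp pal_p} => //; rewrite infix0s.
by have := congr1 size eq_sp; rewrite size_cat size_rcons mem_iota; lia.
Qed.

Lemma infix_rconsr (A : eqType) (s w : seq A) (x : A) :
  infix s (rcons w x) = infix s w || suffix s (rcons w x).
Proof.
apply/idP/orP => [/infixP[p [t]]|[sw|]]; last 2 first.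
- by rewrite -cats1; apply: infix_catr.
- exact: suffixW.
case/lastP: t => [|t y].
  by rewrite cats0 => ->; right; apply: suffix_suffix.
by rewrite -!rcons_cat => /rcons_inj[-> _]; left; apply: infix_infix.
Qed.

(** Reversing [p] shows that its suffix [s] is also a prefix of [p], so [s] occurs before the last
    letter. *)
Lemma palindrome_suffix_infix (A : eqType) (s p w : seq A) (x : A) :
  suffix s (rcons w x) -> suffix p (rcons w x) -> rev s = s -> rev p = p ->
  size s < size p -> infix s w.
Proof.
rewrite /suffix !prefixE !size_rev => /eqP es /eqP ep pal_s pal_p lt_sp.
have tp : take (size s) p = s.
  by rewrite -{2}pal_s -es -pal_p -ep take_takel // ltnW.
have /suffixP[p' ep'] : suffix p (rcons w x).
  by rewrite /suffix prefixE size_rev; apply/eqP.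
move: ep'; rewrite -(cat_take_drop (size s) p) tp.
case/lastP: (drop _ _) (size_drop (size s) p) => [/=|d y _]; first by lia.
by rewrite -!rcons_cat => /rcons_inj[-> _]; apply: infix_infix.
Qed.

(** The type of [palindromic_factors w] depends on [size w]; lists of plain words make the factors
    of [w] and of [rcons w x] comparable. *)
Lemma palindromic_factors_enum (A : finType) (w : seq A) :
  exists l : seq (seq A), [/\ uniq l, size l = #|palindromic_factors w|
    & forall s, (s \in l) = infix s w && palindrome s].
Proof.
exists [seq val u | u <- enum (palindromic_factors w)]; split.
- by rewrite map_inj_uniq ?enum_uniq //; apply: val_inj.
- by rewrite size_map -cardE.
move=> s; apply/mapP/idP => [[u]|ps]; first by rewrite mem_enum inE => pu ->.
have sz : size s <= size w by case/andP: ps => /size_infix.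
by exists (Bseq sz); rewrite ?mem_enum ?inE.
Qed.

Lemma card_palindromic_factors (A : finType) (w : seq A) (l : seq (seq A)) :
  uniq l -> (forall s, (s \in l) = infix s w && palindrome s) ->
  #|palindromic_factors w| = size l.
Proof.
have [l' [uniq_l' <- mem_l']] := palindromic_factors_enum w => uniq_l mem_l.
by apply/perm_size/uniq_perm => // s; rewrite mem_l mem_l'.
Qed.

(** Every palindromic factor gained is a suffix, and of two palindromic suffixes the shorter one
    already occurs in [w]; hence at most one is gained. *)
Lemma card_palindromic_factors_rcons (A : finType) (w : seq A) (x : A) :
  #|palindromic_factors (rcons w x)| = #|palindromic_factors w| + new_pal w x.
Proof.
have [l [uniq_l <- mem_l]] := palindromic_factors_enum w.
case: new_palP => [[s [p [eq_sp pal_p np]]]|no_new].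
  rewrite addn1 -[(size l).+1]/(size (p :: l)); apply: card_palindromic_factors => /= [|q].
    by rewrite uniq_l mem_l (negbTE np).
  have suff_p : suffix p (rcons w x) by rewrite eq_sp suffix_suffix.
  rewrite inE mem_l infix_rconsr; apply/orP/andP => [[/eqP->|/andP[-> ->]]|] //.
    by rewrite suff_p orbT /palindrome pal_p.
  case=> [/orP[->|suff_q]] pal_q; first by right.
  case: (ltngtP (size q) (size p)) => [lt|lt|eq].
  - by right; rewrite pal_q (palindrome_suffix_infix suff_q suff_p) ?(eqP pal_q).
  - by rewrite (palindrome_suffix_infix suff_p suff_q) ?(eqP pal_q) in np.
  - left; have /suffixP[t et] := suff_q.
    have sz : size t = size s by have := congr1 size et; rewrite eq_sp !size_cat eq => /addIn.
    by move/eqP: et; rewrite eq_sp eqseq_cat // => /andP[_]; rewrite eq_sym.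
rewrite addn0; apply: card_palindromic_factors => // q.
rewrite mem_l infix_rconsr; case: (boolP (palindrome q)); rewrite ?andbF ?andbT // => pal_q.
case: (boolP (infix q w)) => //= nq; apply/esym/negP => /suffixP[s es].
by case: no_new; exists s, q; rewrite nq (eqP pal_q).
Qed.


Lemma rich_nil (A : finType) : @rich A [::].
Proof.
rewrite /rich (@card_palindromic_factors _ _ [:: [::]]) // => s.
by rewrite inE infixs0; case: s.
Qed.

Lemma card_palindromic_factors_le (A : finType) (w : seq A) :
  #|palindromic_factors w| <= (size w).+1.
Proof.
elim/last_ind: w => [|w x IH]; first by have /eqP-> := rich_nil A.
by rewrite card_palindromic_factors_rcons size_rcons; case: new_pal; lia.
Qed.

Lemma rich_rcons (A : finType) (w : seq A) (x : A) :
  rich (rcons w x) = rich w && new_pal w x.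
Proof.
rewrite /rich card_palindromic_factors_rcons size_rcons.
by have := card_palindromic_factors_le w; case: new_pal; rewrite /= ?andbT ?andbF; lia.
Qed.

Lemma rich_catl (A : finType) (w u : seq A) : rich (w ++ u) -> rich w.
Proof.
elim/last_ind: u => [|u x IH]; first by rewrite cats0.
by rewrite -rcons_cat rich_rcons => /andP[/IH].
Qed.

(** * The binary morphism and its decoding *)

Fixpoint ext_morph (c : bool) (u : seq bool) : seq bool :=
  if u is x :: u' then
    if x == c then c :: ~~ c :: ext_morph c u' else ~~ c :: ext_morph c u'
  else [::].

(* Compared with [ext_morph], one more separator [~~ c] in front, so that the map
   commutes with reversal. *)
Fixpoint sep_morph (c : bool) (w : seq bool) : seq bool :=
  if w is x :: w' then
    if x == c then ~~ c :: c :: sep_morph c w' else ~~ c :: sep_morph c w'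
  else [:: ~~ c].

Lemma sep_morph_cons c x w :
  sep_morph c (x :: w) =
  if x == c then ~~ c :: c :: sep_morph c w else ~~ c :: sep_morph c w.
Proof. by []. Qed.

Lemma sep_morphE c w : sep_morph c w = ~~ c :: ext_morph c w.
Proof. by elim: w => //= x w ->; case: eqP. Qed.

Lemma ext_morph_cat c u v : ext_morph c (u ++ v) = ext_morph c u ++ ext_morph c v.
Proof. by elim: u => //= x u ->; case: eqP. Qed.

Lemma sep_morph_cat c w u : sep_morph c (w ++ u) = sep_morph c w ++ ext_morph c u.
Proof. by rewrite !sep_morphE ext_morph_cat. Qed.

Lemma sep_morph_rcons c w : sep_morph c (rcons w c) = sep_morph c w ++ [:: c; ~~ c].
Proof. by rewrite -cats1 sep_morph_cat /= eqxx. Qed.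

Lemma sep_morph_rconsN c w : sep_morph c (rcons w (~~ c)) = rcons (sep_morph c w) (~~ c).
Proof. by rewrite -cats1 sep_morph_cat -cats1; case: c. Qed.

Lemma rev_sep_morph c w : rev (sep_morph c w) = sep_morph c (rev w).
Proof.
elim: w => [|x w IH] //; rewrite sep_morph_cons rev_cons.
have [->|nxc] := eqVneq x c.
  by rewrite sep_morph_rcons 2!rev_cons IH -!cats1 -catA.
have -> : x = ~~ c by case: x c nxc {IH} => [] [].
by rewrite sep_morph_rconsN rev_cons IH.
Qed.

(** Decoding from the left is unique: every block begins with [~~ c], and whether a [c] follows
    tells which letter is coded. *)
Lemma sep_morph_prefix c q w t :
  sep_morph c q ++ t = sep_morph c w -> exists2 q', w = q ++ q' & t = ext_morph c q'.
Proof.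
elim: q w => [|x q IH] w; first by rewrite (sep_morphE c w) => -[->]; exists w.
case: w => [|y w]; first by rewrite /= sep_morphE; case: eqP.
rewrite !sep_morph_cons.
have [->|nyc] := eqVneq y c; have [->|nxc] := eqVneq x c; rewrite !cat_cons.
- by case=> /IH[q' -> ->]; exists q'.
- by rewrite !sep_morphE; case: (c).
- by rewrite !sep_morphE; case: (c).
- have -> : y = x by case: x y c nxc nyc {IH} => [] [] [].
  by case=> /IH[q' -> ->]; exists q'.
Qed.

Lemma sep_morph_inj c : injective (sep_morph c).
Proof.
move=> q w e; have := e; rewrite -[sep_morph c q]cats0 => /sep_morph_prefix[q' eq_w].
by rewrite eq_w; case: q' {eq_w} => [|[] q']; rewrite ?cats0 //=; case: c {e}.
Qed.

(** Each [~~ c] of an image opens a block or is the final separator, so the suffix starting there is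
    again an image. *)
Lemma sep_morph_suffix c w s p :
  sep_morph c w = s ++ ~~ c :: p ->
  exists w' q, w = w' ++ q /\ ~~ c :: p = sep_morph c q.
Proof.
elim: w s => [|x w IH] [|y s].
- by move=> /= <-; exists [::], [::].
- by case=> _; case: s.
- by rewrite cat0s => <-; exists [::], (x :: w).
rewrite sep_morph_cons cat_cons; have [->|_] := eqVneq x c; case=> _; last first.
  by move=> /IH[w' [q [-> ->]]]; exists (x :: w'), q.
case: s => [|z s]; first by case; case: (c).
by rewrite cat_cons; case=> _ /IH[w' [q [-> ->]]]; exists (c :: w'), q.
Qed.

Lemma sep_morph_before c w s t :
  sep_morph c w = s ++ c :: t -> exists s', s = rcons s' (~~ c).
Proof.
elim: w s => [|x w IH] [|y s].
- by case; case: (c).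
- by case=> _; case: s.
- by rewrite sep_morphE; case; case: (c).
rewrite sep_morph_cons cat_cons; case: eqP => _; case=> <-; last first.
  by move=> /IH[s' ->]; exists (~~ c :: s').
case: s => [|z s]; first by exists [::].
by rewrite cat_cons; case=> <- /IH[s' ->]; exists [:: ~~ c, c & s'].
Qed.

Lemma sep_morph_after c w s t :
  sep_morph c w = s ++ c :: t -> exists t', t = ~~ c :: t'.
Proof.
move=> /(congr1 rev); rewrite rev_sep_morph rev_cat rev_cons cat_rcons.
move=> /sep_morph_before[s' /(congr1 rev)]; rewrite revK rev_rcons => ->.
by exists (rev s').
Qed.

Lemma rev_sep_morphK c q : rev (sep_morph c q) = sep_morph c q -> rev q = q.
Proof. by rewrite rev_sep_morph => /sep_morph_inj. Qed.

Lemma sep_morph_catl c s w : exists t, sep_morph c (s ++ w) = t ++ sep_morph c w.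
Proof.
elim: s => [|x s [t IH]]; first by exists [::].
rewrite cat_cons sep_morph_cons IH; case: eqP => _; first by exists [:: ~~ c, c & t].
by exists (~~ c :: t).
Qed.

(** An occurrence of [sep_morph c q] starts with [~~ c], hence at a block boundary, and can be
    decoded from there. *)
Lemma infix_sep_morph c q w : infix (sep_morph c q) (sep_morph c w) = infix q w.
Proof.
apply/infixP/infixP => [[s [t]]|[s [t ->]]].
  rewrite (sep_morphE c q) cat_cons => /sep_morph_suffix[w' [v [->]]].
  rewrite -cat_cons -sep_morphE => /sep_morph_prefix[v' -> _].
  by exists w', v'.
have [s' ->] := sep_morph_catl c s (q ++ t).
by exists s', (ext_morph c t); rewrite sep_morph_cat.
Qed.

(** * New letters under the lift *)

Lemma palindrome_ends (A : eqType) (q s : seq A) (x : A) :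
  rev q = q -> q = rcons s x ->
  q = [:: x] \/ exists2 r, q = x :: rcons r x & rev r = r.
Proof.
move=> pal_q eq_q; case: s eq_q => [|y s] eq_q; first by left.
move: pal_q; rewrite eq_q rcons_cons rev_cons rev_rcons rcons_cons.
by case=> -> /rcons_inj[pal_s]; right; exists s.
Qed.

Lemma rev_cons_rcons (A : Type) (r : seq A) (x : A) :
  rev r = r -> rev (x :: rcons r x) = x :: rcons r x.
Proof. by rewrite rev_cons rev_rcons rcons_cons => ->. Qed.

Lemma suffix_rcons_last (A : eqType) (w s q : seq A) (x : A) :
  rcons w x = s ++ q -> q <> [::] -> exists q', q = rcons q' x.
Proof.
by case/lastP: q => // q y; rewrite -rcons_cat => /rcons_inj[_ ->] _; exists q.
Qed.

Lemma new_pal_endsP (A : eqType) (w : seq A) (x : A) : x \in w ->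
  reflect (exists s r, [/\ w = s ++ x :: r, rev r = r & ~~ infix (x :: rcons r x) w])
          (new_pal w x).
Proof.
move=> w_x; apply: (iffP (new_palP w x)) => [[s [q [eq_sq pal_q nq]]]|].
  have q0 : q <> [::] by move=> q0; rewrite q0 infix0s in nq.
  have [q' eq_q'] := suffix_rcons_last eq_sq q0.
  have [eq_q|[r eq_q pal_r]] := palindrome_ends pal_q eq_q'.
    by rewrite eq_q infix1s w_x in nq.
  exists s, r; split=> //; last by rewrite -eq_q.
  by move: eq_sq; rewrite eq_q -rcons_cons -rcons_cat => /rcons_inj[].
move=> [s [r [eq_w pal_r nr]]]; exists s, (x :: rcons r x); split=> //.
  by rewrite {1}eq_w rcons_cat.
exact: rev_cons_rcons.
Qed.

(* Meant for words [w] starting with [c]: then the result starts with [~~ c],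
   and only there contains [c] twice in a row. *)
Definition lift_word (c : bool) (w : seq bool) : seq bool := [:: ~~ c, c & ext_morph c w].

Arguments lift_word : simpl never.

Lemma lift_cons c w : lift_word c (c :: w) = [:: ~~ c, c, c & sep_morph c w].
Proof. by rewrite /lift_word /= eqxx sep_morphE. Qed.

Lemma lift_cat c w u : lift_word c (w ++ u) = lift_word c w ++ ext_morph c u.
Proof. by rewrite /lift_word ext_morph_cat. Qed.

Lemma neqN (c : bool) : c <> ~~ c.
Proof. by case: c. Qed.

(* The suffix palindrome [q] that makes a letter new is transported to
   [sep_morph c q]. *)
Lemma new_lift_other c w : ~~ c \in w ->
  new_pal (c :: w) (~~ c) -> new_pal (lift_word c (c :: w)) (~~ c).
Proof.
move=> w_c /new_pal_endsP[|s [r [eq_w pal_r nr]]]; first by rewrite inE w_c orbT.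
case: s eq_w => [|z s]; first by case=> /neqN.
rewrite cat_cons => -[_ eq_w].
have eq_q : sep_morph c (~~ c :: rcons r (~~ c)) = ~~ c :: rcons (sep_morph c r) (~~ c).
  by rewrite sep_morph_cons sep_morph_rconsN; case: (c).
rewrite lift_cons; apply/new_pal_endsP; first by rewrite inE eqxx.
have [t et] := sep_morph_catl c s (~~ c :: r).
exists [:: ~~ c, c, c & t], (sep_morph c r); split.
- by rewrite eq_w et sep_morph_cons; case: (c).
- by rewrite rev_sep_morph pal_r.
move: nr; rewrite infix_consl negb_or => /andP[_ nr].
rewrite -eq_q 3!infix_consl infix_sep_morph (negbTE nr) eq_q sep_morphE.
by case: (c).
Qed.

(** A new suffix palindrome [c r c] yields first [sep_morph c r] between two letters [c], then the
    full image of [c r c]. The case [r = w] must be excluded: there the front of the lift has a [c]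
    in place of the outer [~~ c]. *)
Lemma new_lift_same c w : rev w <> w -> c \in w ->
  new_pal (c :: w) c ->
  new_pal (lift_word c (c :: w)) c /\ new_pal (rcons (lift_word c (c :: w)) c) (~~ c).
Proof.
move=> npal_w w_c /new_pal_endsP[|s [r [eq_w pal_r nr]]]; first by rewrite inE eqxx.
case: s eq_w => [|z s]; first by case=> eq_w; rewrite eq_w pal_r in npal_w.
rewrite cat_cons => -[_ eq_w].
have [t et] := sep_morph_catl c s (c :: r).
have pal_q := rev_sep_morph c r; rewrite pal_r in pal_q.
have nq : ~~ infix (c :: rcons (sep_morph c r) c) (lift_word c (c :: w)).
  (* The four cases are the possible starting points: each of the three front letters, or inside the
     image of [w]. *)
  apply/negP; rewrite lift_cons 3!infix_consl => /or4P[|||].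
  - by rewrite /=; case: (c).
  - by rewrite sep_morphE /=; case: (c).
  - rewrite /= eqxx => /prefixP[u].
    rewrite -cats1 -catA => /esym/sep_morph_prefix[[|y v] //].
    move=> eq_v /=; case: eqP => [eq_y _|_]; last by case=> /neqN.
    by move: nr; rewrite eq_v eq_y -cat_rcons infix_consl /= eqxx prefix_prefix.
  - move=> /infixP[a [b eq_ab]]; have := eq_ab.
    rewrite cat_cons => /sep_morph_before[a' ea]; move: eq_ab.
    rewrite ea cat_rcons => /sep_morph_suffix[w' [v [ew ev]]].
    have : sep_morph c (c :: r) ++ c :: b = sep_morph c v.
      by rewrite -ev /= eqxx /= cat_rcons.
    move=> /sep_morph_prefix[[|y v'] //= ev']; case: eqP => [ey _|_]; last by case=> /neqN.
    move: nr; rewrite infix_consl ew ev' ey => /negP[].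
    apply/orP; right; apply: infix_catl.
    by rewrite -cat_rcons -cat_cons prefix_infix.
rewrite lift_cons in nq *; split; apply/new_pal_endsP.
- by rewrite !inE eqxx orbT.
- exists ([:: ~~ c, c, c & t] ++ [:: ~~ c]), (sep_morph c r); split=> //.
  by rewrite eq_w et /= eqxx -catA.
- by rewrite inE eqxx.
exists [:: ~~ c, c, c & t], (c :: rcons (sep_morph c r) c); split.
- by rewrite eq_w et /= eqxx -!cats1 -!catA.
- exact: rev_cons_rcons.
rewrite infix_rconsr negb_or; apply/andP; split.
  apply: contra nq => /consl_infix; rewrite -cats1; exact: catr_infix.
apply/negP => /suffixP[u]; rewrite -!rcons_cons -rcons_cat => /rcons_inj[_].
exact: neqN.
Qed.

(** The suffix palindrome of the lift is decoded, for [y = c] after adding a [~~ c] on both sides.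
    The hypotheses on [w] keep it away from the front, which is not part of an image. *)
Lemma new_liftW c w y : rev w <> w -> c \in w -> ~~ c \in w ->
  new_pal (lift_word c (c :: w)) y -> new_pal (c :: w) y.
Proof.
move=> npal_w w_c w_Nc; have [->|] := eqVneq y c; last first.
  move=> nyc; have {y nyc}-> : y = ~~ c by case: y c nyc {w_c w_Nc} => [] [].
  rewrite lift_cons => /new_pal_endsP[|s [r [eq_w pal_r nr]]]; first by rewrite inE eqxx.
  case: s eq_w => [|x [|x' [|x'' s]]].
  - case=> er; move: pal_r; rewrite -er 2!rev_cons rev_sep_morph sep_morphE.
    by case=> /esym/neqN.
  - by case=> _ /neqN.
  - by case=> _ _ /neqN.
  rewrite !cat_cons => -[_ _ _ eq_w].
  have : sep_morph c (rcons w (~~ c)) = s ++ ~~ c :: rcons r (~~ c).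
    by rewrite sep_morph_rconsN eq_w rcons_cat.
  move=> /sep_morph_suffix[w' [q [eq_q eq_r]]].
  have pal_q : rev q = q.
    by apply: (@rev_sep_morphK c); rewrite -eq_r rev_cons_rcons.
  apply/new_palP; exists (c :: w'), q; split=> //; first by rewrite /= eq_q.
  have q0 : q <> [::] by move=> q0; move: eq_r; rewrite q0; case: (r).
  have [q' eq_q'] := suffix_rcons_last eq_q q0.
  rewrite infix_consl negb_or; apply/andP; split.
    have [->|[r' -> _]] := palindrome_ends pal_q eq_q'; by case: (c).
  by apply: contra nr; rewrite -(infix_sep_morph c) -eq_r 3!infix_consl => ->; rewrite !orbT.
rewrite lift_cons => /new_pal_endsP[|s [r [eq_w pal_r nr]]]; first by rewrite !inE eqxx orbT.
(* A start at the second [c] of the front would make [sep_morph c w], hence [w], a palindrome. *)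
case: s eq_w => [|x [|x' [|x'' s]]].
- by case=> /esym/neqN.
- case=> _ er; move: pal_r; rewrite -er rev_cons rev_sep_morph sep_morphE.
  by case=> /esym/neqN.
- by case=> _ _ er; case: npal_w; apply: (@rev_sep_morphK c); rewrite er.
rewrite !cat_cons => -[_ _ _ eq_w].
(* The first [c] has a [~~ c] on its left, and the block of the appended [c] ends with [~~ c]: the
   palindrome widens to one that can be decoded. *)
have [s' es] := sep_morph_before eq_w.
have : sep_morph c (rcons w c) = s' ++ ~~ c :: c :: rcons (rcons r c) (~~ c).
  by rewrite sep_morph_rcons eq_w es cat_rcons -catA -!cats1 /= -catA.
move=> /sep_morph_suffix[w' [q [eq_q eq_r]]].
have pal_q : rev q = q.
  by apply: (@rev_sep_morphK c); rewrite -eq_r -rcons_cons rev_cons_rcons ?rev_cons_rcons.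
apply/new_palP; exists (c :: w'), q; split=> //; first by rewrite /= eq_q.
have q0 : q <> [::] by move=> q0; move: eq_r; rewrite q0.
have [q' eq_q'] := suffix_rcons_last eq_q q0.
rewrite infix_consl negb_or; apply/andP; split; last first.
  apply: contra nr; rewrite -(infix_sep_morph c) -eq_r => /consl_infix.
  by rewrite -rcons_cons -cats1 => /catr_infix; rewrite 3!infix_consl => ->; rewrite !orbT.
have [eq_c|[r' eq_r' _]] := palindrome_ends pal_q eq_q'.
  by move: eq_r; rewrite eq_c /= eqxx; case: (r) => [|? [|? ?]].
(* If [q] is a prefix of [c :: w], the front lacks the first [~~ c] of its image, but
   [c :: rcons r c] still occurs there. *)
apply/negP; rewrite eq_r' /= eqxx => /prefixP[t eq_t].
move: eq_r; rewrite eq_r' /= eqxx sep_morph_rcons => -[].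
rewrite -[[:: c; ~~ c]]/([:: c] ++ [:: ~~ c]) catA !cats1 => /rcons_inj[/rcons_inj[er]].
move: nr; rewrite er eq_t sep_morph_cat sep_morph_rcons => /negP[].
have -> : [:: ~~ c, c, c & (sep_morph c r' ++ [:: c; ~~ c]) ++ ext_morph c t] =
    [:: ~~ c; c] ++ (c :: rcons (sep_morph c r') c) ++ ~~ c :: ext_morph c t.
  by rewrite /= cat_rcons -catA.
exact: infix_infix.
Qed.

(* Here [c] is not new because the square [c; c] already occurs at the front. *)
Lemma new_lift_rcons c w : rev w <> w -> c \in w ->
  ~~ new_pal (rcons (lift_word c (c :: w)) c) c.
Proof.
move=> npal_w w_c; rewrite lift_cons; apply/negP.
case/new_pal_endsP=> [|s [r [eq_w pal_r nr]]]; first by rewrite !inE eqxx orbT.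
case/lastP: r => [|r y] in eq_w pal_r nr *.
  by move: nr; rewrite !rcons_cons 2!infix_consl; case: (c) => //=; case: rcons.
move: eq_w; rewrite -!rcons_cons -rcons_cat => /rcons_inj[eq_w ey].
have [er|[r' er pal_r']] := palindrome_ends pal_r (erefl _).
  move: eq_w; case: r er {pal_r nr} => [_|? [|? ?]] //.
  rewrite sep_morphE lastI cats1 => /(congr1 (last c)).
  rewrite -lastI -sep_morphE /= last_rcons -(revK (sep_morph c w)) rev_sep_morph sep_morphE.
  by rewrite rev_cons last_rcons => /esym/neqN.
have {}eq_w : [:: ~~ c, c, c & sep_morph c w] = s ++ [:: c, c & r'].
  move: er; rewrite -rcons_cons => /rcons_inj[er].
  by rewrite eq_w er ey.
case: s eq_w => [|x [|x' [|x'' s]]].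
- by case=> /esym/neqN.
- by case=> _ er'; case: npal_w; apply: (@rev_sep_morphK c); rewrite er'.
- by rewrite sep_morphE; case=> _ _ /esym/neqN.
by rewrite !cat_cons; case=> _ _ _ /sep_morph_after[t' []] /neqN.
Qed.

(** * Forced extensions and [omega] *)

Fixpoint new_pals (A : eqType) (w u : seq A) : bool :=
  if u is x :: u' then new_pal w x && new_pals (rcons w x) u' else true.

Lemma rich_cat (A : finType) (w u : seq A) : rich (w ++ u) = rich w && new_pals w u.
Proof.
elim: u w => [|x u IH] w; first by rewrite cats0 andbT.
by rewrite -cat_rcons IH rich_rcons -andbA.
Qed.

Lemma richE (A : finType) (w : seq A) : rich w = new_pals [::] w.
Proof. by rewrite -[w in LHS]cat0s rich_cat rich_nil. Qed.

(* After each proper prefix of [u], the next letter of [u] is the only one of [B]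
   that is new; after the whole of [u], at least two are. Palindromes are excluded
   along the way so that a fresh letter put in front of [w] is not new again
   ([new_pal_cons_same]). *)
Fixpoint forced (A : eqType) (B w u : seq A) : Prop :=
  if u is x :: u' then
    [/\ rev w != w, new_pal w x, forall y, y \in B -> y != x -> ~~ new_pal w y
      & forced B (rcons w x) u']
  else exists x y, [/\ x != y, x \in B, y \in B, new_pal w x & new_pal w y].

Lemma forced_rich (A : finType) (B w u : seq A) :
  rich w -> forced B w u -> rich (w ++ u) /\ extends_two_ways (w ++ u).
Proof.
elim: u w => [|x u IH] w rw /=.
  by case=> [x [y [nxy _ _ nx ny]]]; rewrite cats0; split=> //; exists x, y; rewrite !rich_rcons rw.
by case=> _ nx _ /IH; rewrite cat_rcons; apply; rewrite rich_rcons rw.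
Qed.

(** A rich continuation [v] must follow [u] letter by letter, and before the end of [u] there is no
    second choice. *)
Lemma forced_min (A : finType) (B w u v : seq A) : (forall x, x \in B) ->
  forced B w u -> rich (w ++ v) -> extends_two_ways (w ++ v) -> size u <= size v.
Proof.
move=> allB; elim: u w v => [|x u IH] w v //= [_ _ only_x fu].
have {}only_x y : new_pal w y -> y = x.
  by move=> ny; apply/eqP/negPn/negP => /(only_x y (allB y)); rewrite ny.
case: v => [|y v].
  rewrite cats0 => _ [a [b []]]; rewrite !rich_rcons.
  by move=> /eqP nab /andP[_ /only_x ea] /andP[_ /only_x eb]; rewrite ea eb in nab.
rewrite -cat_rcons => rv; have := rich_catl rv; rewrite rich_rcons => /andP[_ /only_x ey].
by rewrite ey in rv *; apply: IH rv.
Qed.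

Lemma omega_forced (A : finType) (B w u : seq A) :
  (forall x, x \in B) -> rich w -> forced B w u -> omega w = size u.
Proof.
move=> allB rw fu; apply: xget_unique => [|k].
  split; first by exists u => //; apply: forced_rich fu.
  by move=> v [rv ev]; apply: forced_min fu rv ev.
case=> [[v [rv ev] <-] min_v]; apply/eqP; rewrite eqn_leq (forced_min allB fu rv ev) andbT.
exact/min_v/(forced_rich rw fu).
Qed.

Lemma leq_phi (A : finType) (w : seq A) : rich w -> omega w <= phi A (size w).
Proof.
move=> rw; rewrite -[w in X in X <= _]/(val (in_tuple w)).
exact: (@leq_bigmax_cond _ _ (fun w : (size w).-tuple A => omega w)).
Qed.

(** * Iterating the lift and counting letters *)

Lemma size_count_bool (c : bool) (u : seq bool) :
  size u = count_mem c u + count_mem (~~ c) u.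
Proof.
rewrite -(count_predC (pred1 c) u); congr (_ + _).
by apply: eq_count => x /=; case: x c => [] [].
Qed.

Lemma count_ext_morph c u : count_mem c (ext_morph c u) = count_mem c u.
Proof.
elim: u => //= x u <-; case: (x == c) => /=; rewrite ?eqxx; last by case: (c).
by case: (c).
Qed.

Lemma count_ext_morphN c u : count_mem (~~ c) (ext_morph c u) = size u.
Proof.
elim: u => //= x u IH; case: (x == c) => /=; rewrite IH eqxx //.
by case: (c).
Qed.

(** A palindrome starting with the square of [~~ c] would also end with it, which gives a second
    occurrence. *)
Lemma marked_nonpalindrome c w :
  ~~ infix [:: ~~ c; ~~ c] [:: ~~ c, c & w] ->
  rev [:: ~~ c, ~~ c, c & w] <> [:: ~~ c, ~~ c, c & w].
Proof.
move=> nsq pal; case/negP: nsq; apply/suffixW.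
have [x [r er]] : exists x r, rev (c :: w) = x :: r.
  by rewrite rev_cons; case: (rev w) => [|x r]; [exists c, [::]|exists x, (rcons r c)].
move: pal; rewrite rev_cons (rev_cons (~~ c)) er -!cats1 -catA /= => -[_ <-].
exact: suffix_suffix.
Qed.

(** The lift starts with [~~ c, c, c], its reverse with an image of a nonempty word, where [c] is
    isolated. *)
Lemma lift_nonpalindrome c w : w <> [::] -> rev (lift_word c (c :: w)) <> lift_word c (c :: w).
Proof.
rewrite lift_cons !rev_cons rev_sep_morph => w0.
have : rev w <> [::] by move=> /(congr1 rev); rewrite revK.
by case: (rev w) => // x v _; rewrite sep_morph_cons sep_morphE; case: ifP; case: (c).
Qed.

Lemma ext_morph_same c u : ext_morph c (c :: u) = [:: c, ~~ c & ext_morph c u].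
Proof. by rewrite /= eqxx. Qed.

Lemma ext_morph_other c u : ext_morph c (~~ c :: u) = ~~ c :: ext_morph c u.
Proof. by case: c. Qed.

Lemma neq_eqN (x c : bool) : x != c -> x = ~~ c.
Proof. by case: x c => [] []. Qed.

(** Since the square of [~~ c] occurs only at the front, [marked_nonpalindrome] supplies the
    hypothesis for transporting new letters at each step. A step by [c] becomes two, the second one
    forced by [new_lift_rcons]. *)
Lemma forced_lift c w u : ~~ infix [:: ~~ c; ~~ c] ([:: ~~ c, c & w] ++ u) ->
  forced [:: true; false] [:: c, ~~ c, ~~ c, c & w] u ->
  forced [:: true; false] (lift_word c [:: c, ~~ c, ~~ c, c & w]) (ext_morph c u).
Proof.
elim: u w => [|x u IH] w nsq.
  have npal : rev [:: ~~ c, ~~ c, c & w] <> [:: ~~ c, ~~ c, c & w].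
    by apply: marked_nonpalindrome; rewrite cats0 in nsq.
  have w_c : c \in [:: ~~ c, ~~ c, c & w] by rewrite !inE eqxx !orbT.
  have w_Nc : ~~ c \in [:: ~~ c, ~~ c, c & w] by rewrite !inE eqxx.
  have new_all y : new_pal [:: c, ~~ c, ~~ c, c & w] y ->
      new_pal (lift_word c [:: c, ~~ c, ~~ c, c & w]) y.
    have [->|] := eqVneq y c; first by case/new_lift_same.
    move=> /neq_eqN->; exact: new_lift_other.
  by case=> x [y [nxy Bx By /new_all nx /new_all ny]]; exists x, y.
have npal : rev [:: ~~ c, ~~ c, c & w] <> [:: ~~ c, ~~ c, c & w].
  apply: marked_nonpalindrome; apply: contra nsq; exact: infix_catr.
have w_c : c \in [:: ~~ c, ~~ c, c & w] by rewrite !inE eqxx !orbT.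
have w_Nc : ~~ c \in [:: ~~ c, ~~ c, c & w] by rewrite !inE eqxx.
set W := lift_word c _.
have npalW : rev W != W by apply/eqP/lift_nonpalindrome.
have only_old z : z \in [:: true; false] -> ~~ new_pal [:: c, ~~ c, ~~ c, c & w] z ->
  ~~ new_pal W z by move=> _; apply/contra/new_liftW.
case=> _ new_x only_x fu.
have {IH}/IH : ~~ infix [:: ~~ c; ~~ c] ([:: ~~ c, c & rcons w x] ++ u).
  by rewrite !cat_cons cat_rcons.
move=> /(_ fu); rewrite -3!rcons_cons -rcons_cons -cats1 lift_cat -/W.
have [ex|nxc] := eqVneq x c.
  rewrite ex in new_x only_x *.
  have [newW newWc] := new_lift_same npal w_c new_x.
  rewrite !ext_morph_same => fu'; split=> //.
    by move=> y By nyc; apply: only_old => //; apply: only_x.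
  rewrite -/W in newWc; split=> //.
  - by rewrite rev_rcons; apply/eqP; case=> /neqN.
  - move=> y _ nyNc; rewrite (neq_eqN nyNc) negbK.
    exact: new_lift_rcons.
  - by rewrite -!cats1 -catA.
have ex := neq_eqN nxc.
rewrite ex in new_x only_x *.
have newW := new_lift_other w_Nc new_x.
rewrite !ext_morph_other cats1 => fu'; split=> //.
by move=> y By nyc; apply: only_old => //; apply: only_x.
Qed.

Lemma rich_lift c w : ~~ infix [:: ~~ c; ~~ c] [:: ~~ c, c & w] ->
  rich [:: c, ~~ c, ~~ c, c & w] -> rich (lift_word c [:: c, ~~ c, ~~ c, c & w]).
Proof.
elim/last_ind: w => [_ _|w x IH]; first by rewrite richE; case: (c); vm_compute.
rewrite -2!rcons_cons -cats1 => nsq'.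
have nsq : ~~ infix [:: ~~ c; ~~ c] [:: ~~ c, c & w].
  by apply: contra nsq'; apply: infix_catr.
have npal := marked_nonpalindrome nsq.
rewrite cats1 -2!rcons_cons rich_rcons => /andP[/(IH nsq) rW].
have w_c : c \in [:: ~~ c, ~~ c, c & w] by rewrite !inE eqxx !orbT.
have w_Nc : ~~ c \in [:: ~~ c, ~~ c, c & w] by rewrite !inE eqxx.
rewrite -cats1 lift_cat; have [->|/neq_eqN->] := eqVneq x c.
  move=> /(new_lift_same npal w_c)[n1 n2].
  by rewrite ext_morph_same -cat_rcons cats1 !rich_rcons rW n1.
by move=> /(new_lift_other w_Nc) n1; rewrite ext_morph_other cats1 rich_rcons rW.
Qed.

Lemma infix_sep_morph_square c w : ~~ infix [:: c; c] (sep_morph c w).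
Proof.
apply/negP => /infixP[s [t]]; rewrite cat_cons => /sep_morph_after[t' []].
by move=> /neqN.
Qed.

Lemma count_lift c w : count_mem c (lift_word c w) = (count_mem c w).+1.
Proof. by rewrite -(count_ext_morph c w) /lift_word; case: c. Qed.

Lemma count_liftN c w : count_mem (~~ c) (lift_word c w) = (size w).+1.
Proof. by rewrite -(count_ext_morphN c) /lift_word; case: c. Qed.

(* The shifts [+ 2] and [+ 1] make the recursion of the letter counts of [W]
   linear, the same as that of the letter counts of [u]. *)
Lemma forced_family (t : nat) : exists c w u,
  let W := [:: c, ~~ c, ~~ c, c & w] in
  [/\ rich W, forced [:: true; false] W u,
      ~~ infix [:: ~~ c; ~~ c] ([:: ~~ c, c & w] ++ u), t <= size W
    & 2 * (count_mem c W + 2) + t + 1 <= 9 * count_mem c u /\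
      2 * (count_mem (~~ c) W + 1) + 1 <= 9 * count_mem (~~ c) u].
Proof.
elim: t => [|t [c [w [u [rW fW nsq le_t [le_c le_Nc]]]]]].
  exists true, [:: true; false; true; true; true; true; false; true; false; true;
      false; true; true; true; false; true; false; true; false; true; true; true;
      false; true; false; true; true; true; false; true; false; true; false; true;
      false; true; true],
    [:: true; false; true; false; true; true; true; false; true; false; true].
  split.
  - by rewrite richE; vm_compute.
  - do 11 (split; [by vm_compute | by vm_compute | by case=> // _; vm_compute | ]).
    by exists true, false; split=> //; vm_compute.
  - by vm_compute.
  - by vm_compute.
  - by split; vm_compute.
(* The front [~~ c, c, c, ~~ c] of the lift is the required front for the exchanged letters. *)
exists (~~ c), (ext_morph c [:: ~~ c, ~~ c, c & w]), (ext_morph c u); rewrite negbK.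
have eW : [:: ~~ c, c, c, ~~ c & ext_morph c [:: ~~ c, ~~ c, c & w]] =
    lift_word c [:: c, ~~ c, ~~ c, c & w].
  by rewrite /lift_word ext_morph_same.
move: rW fW le_t le_c le_Nc; rewrite eW; set W := [:: c, _, _, _ & w].
move=> rW fW le_t le_c le_Nc.
have szW := size_count_bool c W; have szu := size_count_bool c u.
have szlift := size_count_bool c (lift_word c W).
rewrite count_lift count_liftN in szlift.
split.
- by apply: rich_lift rW; apply: contra nsq; apply: infix_catr.
- exact: forced_lift.
- rewrite 2!cat_cons -ext_morph_cat -sep_morphE infix_consl negb_or.
  by rewrite infix_sep_morph_square sep_morphE; case: (c).
- lia.
(* The new first inequality is the sum of the two old ones, whose constants [+ 1] add up to raise
   the slack [t] by one; the new second one follows from the old first. *)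
by rewrite count_lift count_liftN count_ext_morph count_ext_morphN; lia.
Qed.

(** * Passing to an arbitrary alphabet *)

Lemma infix_map (A B : eqType) (f : A -> B) (s w : seq A) : injective f ->
  infix (map f s) (map f w) = infix s w.
Proof.
move=> f_inj.
have prefix_map p v : prefix (map f p) (map f v) = prefix p v.
  by elim: p v => [|x p IH] [|y v] //=; rewrite IH (inj_eq f_inj).
elim: w => [|x w IH]; first by rewrite !infixs0; case: s.
by rewrite map_cons !infix_consl -map_cons prefix_map IH.
Qed.

Lemma new_pal_map (A B : eqType) (f : A -> B) (w : seq A) (x : A) : injective f ->
  new_pal (map f w) (f x) = new_pal w x.
Proof.
move=> f_inj; rewrite /new_pal size_map; apply: eq_has => k.
by rewrite -map_rcons -map_drop -map_rev (inj_eq (inj_map f_inj)) infix_map.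
Qed.

Lemma rich_map (A B : finType) (f : A -> B) (w : seq A) : injective f ->
  rich (map f w) = rich w.
Proof.
move=> f_inj; rewrite !richE -[[::] in LHS]/(map f [::]).
by elim: w [::] => [|x w IH] v //=; rewrite new_pal_map // -map_rcons IH.
Qed.

Lemma forced_map (A B : eqType) (f : A -> B) (l w u : seq A) : injective f ->
  forced l w u -> forced (map f l) (map f w) (map f u).
Proof.
move=> f_inj; elim: u w => [|x u IH] w /=.
  case=> [x [y [nxy lx ly nx ny]]]; exists (f x), (f y).
  by rewrite !new_pal_map // (inj_eq f_inj) !map_f.
case=> npal nx only_x fu; split; rewrite -?map_rev ?(inj_eq (inj_map f_inj)) ?new_pal_map //.
  by move=> _ /mapP[y ly ->]; rewrite (inj_eq f_inj) new_pal_map //; apply: only_x.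
by rewrite -map_rcons; apply: IH.
Qed.

(** A palindromic suffix reaching the front [z] would end with [z], but the last letter [x] differs
    from [z]. *)
Lemma new_pal_cons (A : eqType) (w : seq A) (x z : A) : z \notin rcons w x ->
  new_pal (z :: w) x = new_pal w x.
Proof.
move=> nz; have nzw : z \notin w by move: nz; rewrite mem_rcons inE negb_or => /andP[].
have not_infix p : p <> [::] -> suffix p (rcons w x) -> infix p (z :: w) = infix p w.
  case: p => // y p _ /suffixP[s es]; rewrite infix_consl /=; case: eqP => // ey.
  by move: nz; rewrite es ey mem_cat inE eqxx orbT.
have nonempty p : ~~ infix p w -> p <> [::] by move=> np p0; rewrite p0 infix0s in np.
apply/new_palP/new_palP => [[s [p [es pal_p np]]]|[s [p [es pal_p np]]]].
  have p0 : p <> [::] by move=> p0; rewrite p0 infix0s in np.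
  case: s es => [|y s]; rewrite rcons_cons.
    rewrite cat0s => ep; move: pal_p; rewrite -ep rev_cons rev_rcons rcons_cons.
    by case=> exz _; move: nz; rewrite mem_rcons exz inE eqxx.
  rewrite cat_cons => -[_ es]; exists s, p; split=> //.
  by rewrite -not_infix // es suffix_suffix.
exists (z :: s), p; split=> //; first by rewrite rcons_cons es.
by rewrite not_infix // ?es ?suffix_suffix //; apply: nonempty.
Qed.

(** A palindromic suffix of [z w z] is [z], which already occurs, or the whole word, which would
    make [w] a palindrome. *)
Lemma new_pal_cons_same (A : eqType) (w : seq A) (z : A) : z \notin w -> rev w != w ->
  ~~ new_pal (z :: w) z.
Proof.
move=> nz npal; apply/negP => /new_pal_endsP[|s [r [ew pal_r _]]]; first by rewrite inE eqxx.
case: s ew => [|y s] [] => [ew|_ ew]; first by rewrite ew pal_r eqxx in npal.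
by move: nz; rewrite ew mem_cat inE eqxx orbT.
Qed.


(** The non-palindromes required by [forced] keep [z] from being new, and this condition persists
    because [z :: w] does not end with [z]. *)
Lemma forced_cons (A : eqType) (l w u : seq A) (z : A) :
  z \notin l -> z \notin w ++ u -> w <> [::] ->
  forced l w u -> forced (z :: l) (z :: w) u.
Proof.
move=> nzl; elim: u w => [|x u IH] w nz w0 /=.
  case=> [x [y [nxy lx ly nx ny]]]; exists x, y.
  have nzr v : v \in l -> z \notin rcons w v.
    move=> lv; rewrite mem_rcons inE negb_or; rewrite cats0 in nz; rewrite nz andbT.
    by apply: contra nzl => /eqP->.
  by rewrite !inE lx ly !orbT !new_pal_cons ?nzr.
case=> npal nx only_x fu.
have nzw : z \notin w by apply: contra nz; rewrite mem_cat => ->.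
have nzx : z != x by apply: contra nz => /eqP->; rewrite mem_cat inE eqxx orbT.
split.
- apply/eqP; case/lastP: w w0 nzw {IH nz npal nx only_x fu} => // w y _.
  rewrite rev_cons rev_rcons rcons_cons mem_rcons inE negb_or => /andP[nzy _] [ezy _].
  by rewrite ezy eqxx in nzy.
- by rewrite new_pal_cons // mem_rcons inE negb_or nzx.
- move=> y; rewrite inE; have [-> _ _|nyz /= ly nyx] := eqVneq y z.
    exact: new_pal_cons_same.
  by rewrite new_pal_cons ?only_x // mem_rcons inE negb_or eq_sym nyz.
- by apply: IH fu; rewrite ?cat_rcons //; case: (w).
Qed.


Lemma rich_cons (A : finType) (w : seq A) (z : A) : z \notin w -> rich (z :: w) = rich w.
Proof.
elim/last_ind: w => [_|w x IH nz].
  rewrite -[[:: z]]/(rcons [::] z) rich_rcons rich_nil; apply/new_palP.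
  by exists [::], [:: z].
rewrite -rcons_cons !rich_rcons new_pal_cons // IH //.
by apply: contra nz; rewrite mem_rcons inE => ->; rewrite orbT.
Qed.

Lemma forced_cat (A : finType) (zs l w u : seq A) :
  uniq (zs ++ l) -> {subset w ++ u <= l} -> w <> [::] -> rich w -> forced l w u ->
  rich (zs ++ w) /\ forced (zs ++ l) (zs ++ w) u.
Proof.
move=> + sub w0 rw fw; elim: zs => [|z zs IH] //= /andP[nz /IH[rzw fzw]].
have nzw : z \notin (zs ++ w) ++ u.
  apply: contra nz; rewrite -catA !(mem_cat z zs) => /orP[->//|/sub->].
  by rewrite orbT.
split; last by apply: forced_cons => //; case: (zs) => //; case: (w) w0.
by rewrite rich_cons //; apply: contra nzw; rewrite (mem_cat z (zs ++ w)) => ->.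
Qed.

(** * The lower bound for [phi] *)

Lemma phi_lower_bound (A : finType) (k : nat) : 2 <= #|A| ->
  exists n, k < n /\ 2 * n <= 9 * phi A n.
Proof.
move=> /card_gt1P[a [b [_ _ nab]]].
pose f (c : bool) := if c then a else b.
have f_inj : injective f by case=> [] [] // /eqP; rewrite ?(negbTE nab) // eq_sym (negbTE nab).
pose l := map f [:: true; false].
pose zs := [seq z <- enum A | z \notin l].
(* The part [k.+1] makes the word longer than [k]; [2 * size zs] pays for the letters of [zs] put in
   front. *)
have [c [w [u [rW fW _ le_t [le_c le_Nc]]]]] := forced_family (k.+1 + 2 * size zs).
set W := [:: c, _, _, _ & w] in rW fW le_t le_c le_Nc.
have uniq_zl : uniq (zs ++ l).
  rewrite cat_uniq filter_uniq ?enum_uniq // map_inj_uniq // andbT.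
  by apply/hasPn => x lx; rewrite mem_filter lx.
have all_zl x : x \in zs ++ l by rewrite mem_cat mem_filter mem_enum andbT orNb.
have sub : {subset map f W ++ map f u <= l}.
  by rewrite -map_cat => _ /mapP[x _ ->]; apply: map_f; case: x.
have [||rZ fZ] := forced_cat uniq_zl sub _ _ (forced_map f_inj fW) => //.
  by rewrite rich_map.
exists (size (zs ++ map f W)); split; first by rewrite size_cat size_map; lia.
have := leq_phi rZ; rewrite (omega_forced all_zl rZ fZ) size_map.
move: (phi A _) => p; rewrite size_cat size_map.
move: le_c le_Nc; rewrite (size_count_bool c W) (size_count_bool c u).
move: (size zs) (count_mem _ W) (count_mem _ W) (count_mem _ u) (count_mem _ u).
by lia.
Qed.

Local Open Scope ring_scope.

Theorem corollary6p12 (R : realType) (A : finType) (hA : (2 <= #|A|)%N)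
    (c : R) (hc : 0 < c) (m : nat) (hm : (0 < m)%N) :
  exists n : nat, (m < n)%N /\ (2 / 9 - c) * n%:R <= (phi A n)%:R.
Proof.
have [n [lt_mn le_n]] := phi_lower_bound m hA; exists n; split=> //.
have : (2 * n)%:R <= (9 * phi A n)%:R :> R by rewrite ler_nat.
have : 0 <= c * n%:R by rewrite mulr_ge0 ?ler0n // ltW.
by rewrite !natrM; lra.
Qed.
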